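(* Let $G$ be a finitely presented group. Then the $n$-th nilpotent multiplier $M_n(G)$ is finitely generated for all $n\geq 1$.
   Context: Let $G=F/R$ with $F$ a free group and $R$ a normal subgroup of $F$. The $n$-th nilpotent multiplier of $G$ is $M_n(G)=\dfrac{R\cap\gamma_{n+1}(F)}{\gamma_{n+1}(R,F)}$, where $\gamma_1(R,F)=R$, $\gamma_{k+1}(R,F)=[\gamma_k(R,F),F]$, and $\gamma_k(F)$ is the $k$-th term of the lower central series of $F$ ($\gamma_1(F)=F$). It is an abelian group, independent up to isomorphism of the chosen free presentation, and $M_1(G)\cong H_2(G)$ is the Schur multiplier. *)

(* Defs.v *)
From HB Require Import structures.
From mathcomp Require Import all_boot.
From mathcomp Require Import boolp classical_sets.

Set Implicit Arguments.
Unset Strict Implicit.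
Unset Printing Implicit Defensive.

Local Open Scope classical_set_scope.
Local Open Scope group_scope.

Section Subgroups.
Variable G : groupType.
Implicit Types (A B H N S : set G).

Definition is_subgroup H : Prop :=
  H 1 /\ forall x y, H x -> H y -> H (x / y).

Definition is_normal N : Prop :=
  is_subgroup N /\ forall x g, N x -> N (x ^ g).

Definition generated S : set G := smallest is_subgroup S.

Definition normal_closure S : set G := smallest is_normal S.

Definition commutator_subgroup A B : set G :=
  generated [set z | exists2 a, A a & exists2 b, B b & z = [~ a, b]].

(* gamma H k is gamma_k(H, G) for k >= 1: gamma H 1 = H and
   gamma H k.+2 = [gamma H k.+1, G]; the index 0 is not used.
   The lower central series of G is gamma setT. *)
Definition gamma H (k : nat) : set G :=
  iter k.-1 (fun K => commutator_subgroup K setT) H.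

Lemma is_subgroupT : is_subgroup setT.
Proof. by []. Qed.

Lemma is_normalT : is_normal setT.
Proof. by []. Qed.

Lemma is_subgroupI A B :
  is_subgroup A -> is_subgroup B -> is_subgroup (A `&` B).
Proof.
move=> [A1 Ad] [B1 Bd]; split=> // x y [Ax Bx] [Ay By].
by split; [apply: Ad | apply: Bd].
Qed.

Lemma is_subgroupV H x : is_subgroup H -> H x -> H x^-1.
Proof. by move=> [H1 Hd] Hx; rewrite -[x^-1]mul1g; apply: Hd. Qed.

Lemma is_subgroupM H x y : is_subgroup H -> H x -> H y -> H (x * y).
Proof.
by move=> sH Hx Hy; rewrite -[y]invgK; apply: sH.2 => //; apply: is_subgroupV.
Qed.

Lemma generated_subgroup S : is_subgroup (generated S).
Proof.
split=> [K [[]]//|x y Sx Sy K KS].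
by have [sK _] := KS; apply: sK.2; [apply: Sx | apply: Sy].
Qed.

Lemma sub_generated S : S `<=` generated S.
Proof. exact: sub_smallest. Qed.

Lemma generated_sub S H : is_subgroup H -> S `<=` H -> generated S `<=` H.
Proof. by move=> sH SH; apply: smallest_sub. Qed.

Lemma commutator_subgroupS A B :
  A `<=` B -> commutator_subgroup A setT `<=` commutator_subgroup B setT.
Proof.
move=> AB; apply: generated_sub; first exact: generated_subgroup.
move=> _ [a Aa [b _ ->]]; apply: sub_generated.
by exists a; [apply: AB | exists b].
Qed.

Lemma commutator_subgroup_normal_sub N :
  is_normal N -> commutator_subgroup N setT `<=` N.
Proof.
move=> [sN nN]; apply: generated_sub => // _ [a Na [b _ ->]].
rewrite /commg; apply: (is_subgroupM sN); [exact: is_subgroupV | exact: nN].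
Qed.

Lemma commutator_subgroup_normal N :
  is_normal N -> is_normal (commutator_subgroup N setT).
Proof.
move=> nN; split; first exact: generated_subgroup.
move=> x g Cx.
have -> : x ^ g = x * [~ x, g] by rewrite /commg mulgA mulgV mul1g.
apply: (is_subgroupM (generated_subgroup _)) => //.
apply: sub_generated; exists x; last by exists g.
exact: commutator_subgroup_normal_sub nN _ Cx.
Qed.

Lemma gamma_normal N k : is_normal N -> is_normal (gamma N k).
Proof.
rewrite /gamma => nN.
by elim: k.-1 => //= m IHm; apply: commutator_subgroup_normal.
Qed.

Lemma gamma_sub N k : is_normal N -> gamma N k `<=` N.
Proof.
case: k => [|k] nN; rewrite ?/gamma /=; [exact: subset_refl|]; elim: k => // k IHk.
apply: subset_trans IHk.
exact: (commutator_subgroup_normal_sub (gamma_normal k.+1 nN)).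
Qed.

Lemma gammaS A B k : A `<=` B -> gamma A k `<=` gamma B k.
Proof.
rewrite /gamma => AB.
by elim: k.-1 => //= m IHm; apply: commutator_subgroupS.
Qed.

End Subgroups.

Record subgroup (G : groupType) := Subgroup {
  subgroup_set :> set G;
  subgroupP : is_subgroup subgroup_set }.

Record normal_subgroup (G : groupType) := NormalSubgroup {
  normal_set :> set G;
  normalP : is_normal normal_set }.

Section SubgroupType.
Variables (G : groupType) (H : subgroup G).

Record subgroup_type := SubgroupElt {
  subgroup_val : G;
  _ : subgroup_val \in subgroup_set H }.

HB.instance Definition _ := [isSub for subgroup_val].
HB.instance Definition _ := [Choice of subgroup_type by <:].

Fact subgroup_closed : group_closed (mem (subgroup_set H)).
Proof.
have [H1 Hd] := subgroupP H.
split; first exact/mem_set.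
by move=> x y /set_mem Hx /set_mem Hy; apply/mem_set/Hd.
Qed.

HB.instance Definition _ :=
  SubChoice_isSubGroup.Build G _ subgroup_type subgroup_closed.

End SubgroupType.

Section QuotientGroup.
Variables (G : groupType) (N : normal_subgroup G).
Local Open Scope quotient_scope.

Definition coset_rel (x y : G) : bool := `[< normal_set N (x^-1 * y) >].

Fact coset_rel_refl : reflexive coset_rel.
Proof. by move=> x; apply/asboolP; rewrite mulVg; case: (normalP N) => -[]. Qed.

Fact coset_rel_sym : symmetric coset_rel.
Proof.
have sN := (normalP N).1.
by move=> x y; apply/asboolP/asboolP => /(is_subgroupV sN); rewrite invgM invgK.
Qed.

Fact coset_rel_trans : transitive coset_rel.
Proof.
have sN := (normalP N).1.
move=> y x z /asboolP xy /asboolP yz; apply/asboolP.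
by have := is_subgroupM sN xy yz; rewrite mulgA mulgK.
Qed.

Canonical coset_equiv :=
  EquivRel coset_rel coset_rel_refl coset_rel_sym coset_rel_trans.

Definition quotient_group := {eq_quot coset_equiv}.

HB.instance Definition _ := Choice.on quotient_group.
HB.instance Definition _ := EqQuotient.on quotient_group.

Definition quotient_one : quotient_group := \pi_quotient_group 1.
Definition quotient_mul (u v : quotient_group) : quotient_group :=
  \pi_quotient_group (repr u * repr v).
Definition quotient_inv (u : quotient_group) : quotient_group :=
  \pi_quotient_group (repr u)^-1.

Lemma quotient_eqP (x y : G) :
  (\pi_quotient_group x = \pi_quotient_group y) <-> normal_set N (x^-1 * y).
Proof.
split=> [/eqmodP/asboolP //|Nxy]; apply/eqmodP; exact/asboolP.
Qed.

Lemma repr_coset (x : G) : normal_set N (x^-1 * repr (\pi_quotient_group x)).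
Proof. by apply/quotient_eqP; rewrite reprK. Qed.

Lemma pi_quotientM (x y : G) :
  \pi_quotient_group (x * y) =
  quotient_mul (\pi_quotient_group x) (\pi_quotient_group y).
Proof.
have [sN nN] := normalP N; apply/quotient_eqP.
set x' := repr _; set y' := repr _.
have -> : (x * y)^-1 * (x' * y') = (x^-1 * x') ^ y * (y^-1 * y').
  by rewrite /conjg invgM !mulgA mulgK.
by apply: (is_subgroupM sN); [apply: nN|]; apply: repr_coset.
Qed.

Lemma pi_quotientV (x : G) :
  \pi_quotient_group x^-1 = quotient_inv (\pi_quotient_group x).
Proof.
have [sN nN] := normalP N; apply/quotient_eqP.
set x' := repr _; rewrite invgK.
have -> : x * x'^-1 = ((x^-1 * x')^-1) ^ x^-1.
  by rewrite /conjg invgM !invgK !mulgA mulgK.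
by apply: nN; apply: (is_subgroupV sN); apply: repr_coset.
Qed.

Fact quotient_mulA : associative quotient_mul.
Proof.
move=> u v w; rewrite -[u]reprK -[v]reprK -[w]reprK.
move: (repr u) (repr v) (repr w) => x y z.
rewrite -(pi_quotientM y z) -(pi_quotientM x (y * z)) -(pi_quotientM x y).
by rewrite -(pi_quotientM (x * y) z) mulgA.
Qed.

Fact quotient_mul1 : left_id quotient_one quotient_mul.
Proof. by move=> u; rewrite -[u]reprK -pi_quotientM mul1g. Qed.

Fact quotient_1mul : right_id quotient_one quotient_mul.
Proof. by move=> u; rewrite -[u]reprK -pi_quotientM mulg1. Qed.

Fact quotient_mulV : left_inverse quotient_one quotient_inv quotient_mul.
Proof.
by move=> u; rewrite -[u]reprK -pi_quotientV -pi_quotientM mulVg.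
Qed.

Fact quotient_Vmul : right_inverse quotient_one quotient_inv quotient_mul.
Proof.
by move=> u; rewrite -[u]reprK -pi_quotientV -pi_quotientM mulgV.
Qed.

HB.instance Definition _ := isGroup.Build quotient_group
  quotient_mulA quotient_mul1 quotient_1mul quotient_mulV quotient_Vmul.

End QuotientGroup.

Definition kernel (G H : groupType) (f : {multiplicative G -> H}) : set G :=
  [set x | f x = 1].

Lemma kernel_normal (G H : groupType) (f : {multiplicative G -> H}) :
  is_normal (kernel f).
Proof.
have f1 : f 1 = 1 by apply: (mulgI (f 1)); rewrite -gmulfM !mulg1.
have fV x : f x^-1 = (f x)^-1.
  by apply: (mulgI (f x)); rewrite -gmulfM !mulgV.
rewrite /kernel; split; first split=> //= x y fx fy.
  by rewrite gmulfM fV fx fy mulgV.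
by move=> x g /= fx; rewrite /conjg !gmulfM fV fx mul1g mulVg.
Qed.

Definition free_basis (X : Type) (F : groupType) (i : X -> F) : Prop :=
  forall (H : groupType) (f : X -> H),
    (exists phi : {multiplicative F -> H}, forall x, phi (i x) = f x) /\
    (forall phi psi : {multiplicative F -> H},
       (forall x, phi (i x) = f x) -> (forall x, psi (i x) = f x) ->
       phi =1 psi).

Definition free_group (F : groupType) : Prop :=
  exists (X : Type) (i : X -> F), free_basis i.

Definition surjective_hom (F G : groupType) (pi : {multiplicative F -> G}) :
  Prop := forall y, exists x, pi x = y.

Definition finitely_generated (G : groupType) : Prop :=
  exists s : seq G, generated [set` s] = setT.

Definition finitely_presented (G : groupType) : Prop :=
  exists (k : nat) (F : groupType) (i : 'I_k -> F)
         (pi : {multiplicative F -> G}) (rels : seq F),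
    [/\ free_basis i, surjective_hom pi &
        kernel pi = normal_closure [set` rels]].

(* For G = F / R, presented by pi : F -> G with R = kernel pi, the group
   (R `&` gamma_{n+1}(F)) / gamma_{n+1}(R, F). *)
Section NilpotentMultiplier.
Variables (F G : groupType) (pi : {multiplicative F -> G}) (n : nat).

Local Notation R := (kernel pi).

Fact multiplier_num_subgroup : is_subgroup (R `&` gamma setT n.+1).
Proof.
apply: is_subgroupI; first exact: (kernel_normal pi).1.
exact: (gamma_normal n.+1 (is_normalT F)).1.
Qed.

Definition multiplier_num : subgroup F := Subgroup multiplier_num_subgroup.

Lemma multiplier_den_sub : gamma R n.+1 `<=` subgroup_set multiplier_num.
Proof.
move=> x Cx; split; first exact: gamma_sub (kernel_normal pi) _ Cx.
exact: (@gammaS F R setT n.+1 (fun _ _ => I) _ Cx).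
Qed.

Fact multiplier_den_normal :
  is_normal [set x : subgroup_type multiplier_num | gamma R n.+1 (val x)].
Proof.
have [[N1 Nd] nN] := gamma_normal n.+1 (kernel_normal pi).
split; first by split=> [|x y /= Nx Ny]; [exact: N1 | exact: Nd].
by move=> x g /= Nx; apply: nN.
Qed.

Definition multiplier_den : normal_subgroup (subgroup_type multiplier_num) :=
  NormalSubgroup multiplier_den_normal.

Definition nilpotent_multiplier : groupType := quotient_group multiplier_den.

End NilpotentMultiplier.

(* Main.v *)
Require Import Defs.
From HB Require Import structures.
From mathcomp Require Import all_boot.
From mathcomp Require Import boolp classical_sets.

Set Implicit Arguments.
Unset Strict Implicit.
Unset Printing Implicit Defensive.

Local Open Scope classical_set_scope.
Local Open Scope group_scope.

(* Let G = F0/R0 with F0 free on finitely many generators and R0 the normal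
   closure of finitely many relators.  Each gamma_k(R0,F0)/gamma_{k+1}(R0,F0) is
   central and generated by the finitely many commutators [r, x_1, .., x_{k-1}]
   of relators with generators, so R0/gamma_{n+1}(R0,F0) is polycyclic and all
   its subgroups are finitely generated.  For another free presentation F/R,
   lift the identity of G to maps F0 -> F -> F0; since [gamma_j(R,F), gamma_k(F)]
   is contained in gamma_{j+k}(R,F), the composite F -> F0 -> F is the identity
   on gamma_{n+1}(F) modulo gamma_{n+1}(R,F), hence the multiplier computed from
   F0 surjects onto the one computed from F. *)

(** * Commutator identities modulo a normal subgroup *)

Section CommutatorCalculus.
Variable G : groupType.
Implicit Types (x y z g : G) (A N : set G).

Lemma commMg x y z : [~ x * y, z] = [~ x, z] ^ y * [~ y, z].
Proof. by rewrite /commg /conjg !gnorm. Qed.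

Lemma commVg x z : [~ x^-1, z] = ([~ x, z] ^ x^-1)^-1.
Proof. by rewrite /commg /conjg !gnorm. Qed.

Lemma Hall_Witt x y z :
  [~ x, y^-1, z] ^ y * [~ y, z^-1, x] ^ z * [~ z, x^-1, y] ^ x = 1.
Proof. by rewrite /commg /conjg !gnorm. Qed.

Lemma normal_conj N x g : is_normal N -> N x <-> N (x ^ g).
Proof. by case=> _ nN; split=> [|/(nN _ g^-1)]; [exact: nN | rewrite conjgK]. Qed.

(** Reduces commutator conditions modulo [N] to generators; it rests on [xy, a] = [x, a]^y
    [y, a]. *)
Lemma commg_mod_subgroup N A : is_normal N ->
  is_subgroup [set z | forall a, A a -> N [~ z, a]].
Proof.
move=> [sN nN]; split=> [a _|x y /= Nx Ny a Aa].
  by rewrite comm1g; apply: sN.1.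
rewrite commMg commVg; apply: (is_subgroupM sN); first exact/nN/Nx.
by apply: (is_subgroupV sN); apply/nN/Ny.
Qed.

Lemma central_mod_subgroup N : is_normal N ->
  is_subgroup [set z | forall a, N [~ z, a]].
Proof.
move=> /(commg_mod_subgroup setT).
by congr is_subgroup; apply/seteqP; split=> z Nz a; [apply: Nz | move=> _].
Qed.

Lemma commg_sym_mod N x y : is_subgroup N -> N [~ x, y] -> N [~ y, x].
Proof. by move=> sN; rewrite -invgR => /(is_subgroupV sN); rewrite invgK. Qed.

End CommutatorCalculus.

(* MathComp states [gmulf1] and its consequences only for morphisms of unital
   magmas, whereas [{multiplicative _ -> _}] is a bare magma morphism. *)
Section GroupHom.
Variables (F G : groupType) (f : {multiplicative F -> G}).

Lemma homg1 : f 1 = 1.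
Proof. by apply: (mulgI (f 1)); rewrite -gmulfM !mulg1. Qed.

Lemma homgV x : f x^-1 = (f x)^-1.
Proof. by apply: (mulgI (f x)); rewrite -gmulfM !mulgV homg1. Qed.

Lemma homgF x y : f (x / y) = f x / f y.
Proof. by rewrite gmulfM homgV. Qed.

Lemma homgR x y : f [~ x, y] = [~ f x, f y].
Proof. by rewrite /commg /conjg !gmulfM !homgV. Qed.

Lemma preimage_subgroup (A : set G) : is_subgroup A -> is_subgroup (f @^-1` A).
Proof.
by case=> A1 Ad; split=> [|x y]; rewrite /= ?homg1 ?homgF //; apply: Ad.
Qed.

End GroupHom.

(** * The relative lower central series *)

Section Gamma.
Variable G : groupType.
Implicit Types (x y z g : G) (N R : set G).

Lemma gamma_comm R k x g : gamma R k.+1 x -> gamma R k.+2 [~ x, g].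
Proof. by move=> Rx; apply: sub_generated; exists x => //; exists g. Qed.

Lemma gammaS_sub R k : is_normal R -> gamma R k.+2 `<=` gamma R k.+1.
Proof.
by move=> nR; apply: commutator_subgroup_normal_sub (gamma_normal k.+1 nR).
Qed.

(** Consecutive terms of the series have a central quotient, so conjugation moves an element of [L]
    only by an element of [gamma R k.+2]. *)
Lemma gamma_between_normal R k (L : set G) : is_normal R -> is_subgroup L ->
  gamma R k.+2 `<=` L -> L `<=` gamma R k.+1 -> is_normal L.
Proof.
move=> nR sL NL LR; split=> // x g Lx.
have -> : x ^ g = x * [~ x, g] by rewrite /commg mulVKg.
by apply: (is_subgroupM sL) => //; apply: NL; apply: gamma_comm; apply: LR.
Qed.

(* Induction on [k], using the three subgroups lemma. *)
Lemma gamma_comm_gamma R j k x y : is_normal R ->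
  gamma R j.+1 x -> gamma setT k.+1 y -> gamma R (j + k).+2 [~ x, y].
Proof.
move=> nR; elim: k j x y => [|k IHk] j x y Rx.
  by rewrite addn0 => _; apply: gamma_comm.
have nK := gamma_normal (j + k.+1).+2 nR; set K := gamma R _ in nK *.
suff Ksub : gamma setT k.+2 `<=`
    [set z | forall a, gamma R j.+1 a -> K [~ z, a]].
  by move=> /Ksub/(_ x Rx); apply: commg_sym_mod nK.1.
apply: generated_sub; first exact: commg_mod_subgroup.
move=> _ [z Fz [g _ ->]] a Ra.
(* Of the other two Hall-Witt factors, [a, z^-1, g^-1] is handled by induction at [j] and one more
   commutator, [g^-1, a^-1, z] by induction at [j.+1]. *)
have := Hall_Witt z g^-1 a; rewrite invgK.
move=> /(canRL (mulgK _)); rewrite mul1g => /(canRL (mulgK _)) HW.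
apply/(normal_conj _ g^-1 nK); rewrite HW.
have sK := nK.1; apply: (is_subgroupM sK); apply: (is_subgroupV sK).
  apply: nK.2; rewrite /K addnS; apply: gamma_comm; apply: IHk => //.
  by apply: is_subgroupV Fz; apply: (gamma_normal _ (is_normalT G)).1.
apply: nK.2; rewrite /K addnS -addSn; apply: IHk => //.
apply: (commg_sym_mod (gamma_normal _ nR).1).
by apply: gamma_comm; exact: is_subgroupV (gamma_normal _ nR).1 Ra.
Qed.

(** Write h(x) = xr and h(g) = gs. In the expansion of [xr, gs] every factor beyond [x, g] is a
    conjugate of a commutator involving r or s, and [gamma_comm_gamma] places it deep enough. *)
Lemma gamma_endo_congr R (h : {multiplicative G -> G}) k x : is_normal R ->
  (forall x, R (x^-1 * h x)) -> gamma setT k.+1 x -> gamma R k.+1 (x^-1 * h x).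
Proof.
move=> nR hR; elim: k x => [|k IHk] x; first by move=> _; apply: hR.
have nK := gamma_normal k.+2 nR; set K := gamma R _ in nK *.
have sK := nK.1.
have sub : is_subgroup [set x | K (x^-1 * h x)].
  split=> [|{}x y /= Kx Ky]; first by rewrite /= homg1 mulg1 invg1; apply: sK.1.
  have -> : (x / y)^-1 * h (x / y) = (x^-1 * h x) ^ y^-1 / (y^-1 * h y) ^ y^-1.
    by rewrite homgF /conjg !gnorm.
  by apply: sK.2; apply: nK.2.
have gen : commutator_subgroup (gamma setT k.+1) setT `<=`
    [set x | K (x^-1 * h x)].
  apply: generated_sub => // _ [{}x Fx [g _ ->]] /=.
  have Rr := IHk _ Fx; have Rs := hR g; rewrite homgR.
  rewrite -[h x](mulKg x^-1) -[h g](mulKg g^-1) !invgK.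
  set r := x^-1 * h x in Rr *; set s := g^-1 * h g in Rs *.
  have -> : [~ x, g]^-1 * [~ x * r, g * s] =
      ([~ x, s] ^ r * [~ r, s]) ^ [~ x, g] *
      [~ [~ x, g], r * s] * [~ r, g] ^ s.
    by rewrite /commg /conjg !gnorm.
  have comR a b m : gamma setT m.+1 a -> R b -> gamma R m.+2 [~ a, b].
    move=> Fa Rb; apply: (commg_sym_mod (gamma_normal _ nR).1).
    exact: (@gamma_comm_gamma R 0 m).
  apply: (is_subgroupM sK); last by apply: nK.2; apply: gamma_comm.
  apply: (is_subgroupM sK).
    apply: nK.2; apply: (is_subgroupM sK); last exact: gamma_comm.
    by apply: nK.2; apply: comR.
  apply: comR; first by apply: gammaS_sub => //; apply: gamma_comm.
  by apply: (is_subgroupM nR.1) => //; apply: gamma_sub nR _ Rr.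
exact: gen.
Qed.

End Gamma.

Lemma gamma_morph (F G : groupType) (f : {multiplicative F -> G})
    (A : set F) (B : set G) k :
  A `<=` f @^-1` B -> gamma A k `<=` f @^-1` (gamma B k).
Proof.
rewrite /gamma => fAB; elim: k.-1 => //= m IHm.
apply: generated_sub => [|_ [a Aa [b _ ->]] /=].
  exact/preimage_subgroup/generated_subgroup.
by rewrite homgR; apply: sub_generated; exists (f a); [apply: IHm | exists (f b)].
Qed.

(** * Finite generation of subgroups modulo a normal subgroup *)

Section Noetherian.
Variable G : groupType.
Implicit Types (x y a : G) (s t : seq G) (H K L N : set G).

(** Quotients are avoided: everything stays inside [G], so the modulus can vary along a series. *)
Definition gen_mod N s : set G := generated ([set` s] `|` N).

Definition fg_mod N L : Prop :=
  exists2 s, [set` s] `<=` L & L `<=` gen_mod N s.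

(* [N] need not lie in [L]: for [N] normal, this says that every subgroup of
   [H N / N] is finitely generated. *)
Definition noetherian_mod N H : Prop :=
  forall L, is_subgroup L -> L `<=` H -> fg_mod N L.

Lemma gen_mod_subgroup N s : is_subgroup (gen_mod N s).
Proof. exact: generated_subgroup. Qed.

Lemma gen_mod_seq N s : [set` s] `<=` gen_mod N s.
Proof. by move=> x sx; apply: sub_generated; left. Qed.

Lemma gen_mod_base N s : N `<=` gen_mod N s.
Proof. by move=> x sx; apply: sub_generated; right. Qed.

Lemma gen_mod_sub N s H :
  is_subgroup H -> [set` s] `<=` H -> N `<=` H -> gen_mod N s `<=` H.
Proof.
by move=> sH sH' NH; apply: generated_sub => // x [] ?; [apply: sH' | apply: NH].
Qed.

(** The right-hand set is the product LK, a subgroup because [K] is normal. *)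
Lemma gen_mod_decomp K s L : is_normal K -> is_subgroup L -> [set` s] `<=` L ->
  gen_mod K s `<=` [set x | exists2 u, L u & K (u^-1 * x)].
Proof.
move=> [sK nK] sL Ls; apply: gen_mod_sub => [|x sx|x Kx] /=; last first.
- by exists 1; [exact: sL.1 | rewrite invg1 mul1g].
- by exists x; [exact: Ls | rewrite mulVg; exact: sK.1].
split=> [|x y /= [u Lu Ku] [v Lv Kv]].
  by exists 1; [exact: sL.1 | rewrite mulVg; exact: sK.1].
exists (u / v); first exact: sL.2.
have -> : (u / v)^-1 * (x / y) = (u^-1 * x) ^ v^-1 / (v^-1 * y) ^ v^-1.
  by rewrite /conjg !gnorm.
by apply: sK.2; apply: nK.
Qed.

(** Generators of [L] modulo [K] together with generators of the intersection of [L] and [K] modulo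
    [N] generate [L] modulo [N]. *)
Lemma noetherian_trans N K H : is_normal K ->
  noetherian_mod N K -> noetherian_mod K H -> noetherian_mod N H.
Proof.
move=> nK NK KH L sL LH; have [s Ls sLgen] := KH L sL LH.
have [x [Lx _] //|t LKt tgen] := NK _ (is_subgroupI sL nK.1).
exists (s ++ t) => [x /= |x Lx].
  by rewrite mem_cat => /orP[/Ls//|/LKt[]].
have sub_st : gen_mod N t `<=` gen_mod N (s ++ t).
  apply: gen_mod_sub (gen_mod_subgroup _ _) _ (@gen_mod_base _ _) => y ty.
  by apply: gen_mod_seq; rewrite /= mem_cat ty orbT.
(* Keeping [u] in [L] as well puts [u^-1 * x] in both [L] and [K]. *)
have [u [Lu su] Ku] : exists2 u, (L `&` gen_mod N (s ++ t)) u & K (u^-1 * x).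
  apply: gen_mod_decomp (sLgen _ Lx) => //.
    by apply: is_subgroupI => //; apply: gen_mod_subgroup.
  move=> y sy; split; first exact: Ls.
  by apply: gen_mod_seq; rewrite /= mem_cat sy.
rewrite -(mulVKg u x); apply: is_subgroupM (gen_mod_subgroup _ _) su _.
apply: sub_st; apply: tgen; split=> //.
by apply: is_subgroupM => //; apply: is_subgroupV.
Qed.

(** Integer powers of [a], encoded by pairs of natural exponents. *)
Lemma cyclic_subgroup a : is_subgroup [set x | exists m n, x = a ^+ m / a ^+ n].
Proof.
split=> [|_ _ [m [n ->]] [p [q ->]]]; first by exists 0, 0; rewrite mulgV.
exists (m + q), (n + p); rewrite invgF !mulgA expgnDr addnC expgnDr invgM !mulgA.
congr (_ / _); rewrite -!mulgA; congr (_ * _).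
by apply/commute_sym/commuteV/commuteX2.
Qed.

Lemma noetherian_cyclic K a : is_normal K -> noetherian_mod K (gen_mod K [:: a]).
Proof.
move=> nK L sL La; have [sK nKJ] := nK.
have pow x : L x -> exists m, exists2 y, y = x \/ y = x^-1 & K (a ^- m * y).
  move=> Lx; have [_ [m [n ->]]] : exists2 u,
      [set x | exists m n, x = a ^+ m / a ^+ n] u & K (u^-1 * x).
    apply: gen_mod_decomp (La _ Lx) => //; first exact: cyclic_subgroup.
    by move=> _ /=/[!inE]/eqP->; exists 1%N, 0; rewrite !gnorm.
  have [le_nm|/ltnW le_mn] := leqP n m.
    by rewrite -expgnFr //; exists (m - n), x => //; left.
  rewrite invgF -expgnFr // => /(is_subgroupV sK) Kx.
  exists (n - m), x^-1; first by right.
  by have := nKJ _ x^-1 Kx; rewrite /conjg !gnorm.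
(* As for subgroups of the integers, the least positive exponent occurring in [L] gives a generator;
   if there is none, [L] lies in [K]. *)
pose P d := `[< (0 < d)%N /\ exists2 y, L y & K (a ^- d * y) >].
have [exP|noP] := pselect (exists d, P d); last first.
  exists [::] => // x Lx; apply: gen_mod_base.
  have [[|m] [y yx]] := pow x Lx; last first.
    move=> Ky; case: noP; exists m.+1; apply/asboolP; split=> //; exists y => //.
    by case: yx => ->//; apply: is_subgroupV.
  by rewrite !gnorm; case: yx => -> // /(is_subgroupV sK); rewrite invgK.
case: (ex_minnP exP) => d /asboolP[d_gt0 [y Ly Ky]] dmin.
have sy := gen_mod_subgroup K [:: y].
have yy : gen_mod K [:: y] y by apply: gen_mod_seq; rewrite /= inE.
(* Euclidean division by repeated subtraction: [y^-1 * x] has exponent lower by [d]. *)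
have main m : forall x, L x -> K (a ^- m * x) -> gen_mod K [:: y] x.
  elim/ltn_ind: m => -[|m] IHm x Lx Kx.
    by apply: gen_mod_base; move: Kx; rewrite !gnorm.
  have le_dm : (d <= m.+1)%N by apply: dmin; apply/asboolP; split=> //; exists x.
  rewrite -(mulVKg y x); apply: (is_subgroupM sy) => //.
  apply: (IHm (m.+1 - d)).
  - by rewrite ltn_subrL d_gt0.
  - by apply: is_subgroupM => //; apply: is_subgroupV.
  have -> : a ^- (m.+1 - d) * (y^-1 * x) =
      (a ^- d * y)^-1 ^ (a ^+ (m.+1 - d)) * (a ^- m.+1 * x).
    by rewrite -[in a ^- m.+1](subnKC le_dm) expgnDr /conjg !gnorm.
  by apply: (is_subgroupM sK) => //; apply: nKJ; exact: is_subgroupV sK Ky.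
exists [:: y] => [_ /=/[!inE]/eqP-> //|x Lx].
have [m [z [->|->] Kz]] := pow x Lx; first exact: main Kz.
rewrite -[x]invgK; apply: (is_subgroupV sy); apply: main Kz.
exact: is_subgroupV.
Qed.

(** Generators are added one at a time: each stage is normal because [s] is central modulo [N], and
    the next stage is cyclic over it. *)
Lemma noetherian_central N s : is_normal N ->
  (forall x g, x \in s -> N [~ x, g]) -> noetherian_mod N (gen_mod N s).
Proof.
move=> nN; elim: s => [_|a s IHs sN] L sL LN.
  by exists [::] => // x /LN.
have sN' x g : x \in s -> N [~ x, g] by move=> xs; apply: sN; rewrite inE xs orbT.
have sK := gen_mod_subgroup N s.
have nK : is_normal (gen_mod N s).
  split=> // x g Kx; have -> : x ^ g = x * [~ x, g] by rewrite /commg mulVKg.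
  apply: (is_subgroupM sK) => //; apply: gen_mod_base.
  move: x Kx g; apply: gen_mod_sub => [|x /= xs g|x Nx g].
  - exact: central_mod_subgroup.
  - exact: sN'.
  - rewrite /commg; apply: (is_subgroupM nN.1); last exact: nN.2.
    exact: is_subgroupV nN.1 Nx.
apply: (noetherian_trans nK (IHs sN') (noetherian_cyclic (a := a) nK) sL) => x /LN.
apply: gen_mod_sub; first exact: gen_mod_subgroup.
  move=> y /=; rewrite inE => /orP[/eqP->|ys].
    by apply: gen_mod_seq; rewrite /= inE.
  by apply: gen_mod_base; apply: gen_mod_seq.
by move=> y Ny; do 2 apply: gen_mod_base.
Qed.

End Noetherian.

(** * Finite generation of the layers for finitely many relators *)

Section GammaGenerators.
Variables (G : groupType) (e r : seq G).
Hypothesis genG : generated [set` e] = setT.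

Local Notation R := (normal_closure [set` r]).

Lemma normal_closure_normal (S : set G) : is_normal (normal_closure S).
Proof.
split; first split=> [K [[]//]|x y Sx Sy K KS].
- by move=> [].
- by have [[sK _] _] := KS; apply: sK.2; [apply: Sx | apply: Sy].
- by move=> x g Sx K KS; have [nK _] := KS; apply: nK.2; apply: Sx.
Qed.

(** The index counts the generators in [r, x_1, .., x_k], so these elements belong to the term
    [k.+1] of the series. *)
Fixpoint gamma_gens k : seq G :=
  if k is k'.+1 then [seq [~ x, y] | x <- gamma_gens k', y <- e] else r.

Lemma gamma_gens_sub k : [set` gamma_gens k] `<=` gamma R k.+1.
Proof.
elim: k => [|k IHk] x /=; first by move=> rx K [_]; apply.
by move=> /allpairsP[[a b] /= [/IHk Ra _ ->]]; apply: gamma_comm.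
Qed.

(** The span [K] is normal by centrality of the layer. In degree 0 it thus absorbs conjugates of
    relators; later, [a, b] may be tested for membership in [K] on generators of both arguments. *)
Lemma gamma_gens_gen k : gamma R k.+1 `<=` gen_mod (gamma R k.+2) (gamma_gens k).
Proof.
have nR := normal_closure_normal [set` r].
elim: k => [|k IHk]; set K := gen_mod _ _.
  have nK : is_normal K.
    apply: (@gamma_between_normal _ R 0 _ nR (gen_mod_subgroup _ _)).
      exact: gen_mod_base.
    by apply: gen_mod_sub nR.1 (@gamma_gens_sub 0) (@gammaS_sub _ _ 0 nR).
  by apply: smallest_sub => //; apply: gen_mod_seq.
have nK : is_normal K.
  apply: (@gamma_between_normal _ R k.+1 _ nR (gen_mod_subgroup _ _)).
    exact: gen_mod_base.
  apply: gen_mod_sub (gamma_normal k.+2 nR).1 (@gamma_gens_sub k.+1) _.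
  exact: gammaS_sub.
have sK := nK.1.
apply: generated_sub => // _ [a Ra [b _ ->]].
move: a {Ra}(IHk _ Ra) b; apply: (@gen_mod_sub _ _ _ [set a | forall b, K [~ a, b]]).
- exact: central_mod_subgroup.
- move=> a ka b; apply: (commg_sym_mod sK).
  have : generated [set` e] b by rewrite genG.
  suff sub : generated [set` e] `<=`
      [set z | forall x, x \in gamma_gens k -> K [~ z, x]] by move/sub; apply.
  apply: generated_sub; first exact: (commg_mod_subgroup _ nK).
  move=> {}b eb {}a {}ka; apply: (commg_sym_mod sK).
  by apply: gen_mod_seq; apply/allpairsP; exists (a, b).
- by move=> a Ra b; apply: gen_mod_base; apply: gamma_comm.
Qed.

(** The series is descended one layer at a time, each layer being central and finitely generated. *)
Lemma noetherian_gamma k : noetherian_mod (gamma R k.+1) R.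
Proof.
have nR := normal_closure_normal [set` r].
elim: k => [|k IHk].
  by move=> L sL LR; exists [::] => // x /LR; apply: gen_mod_base.
apply: noetherian_trans (gamma_normal k.+1 nR) _ IHk.
move=> L sL /subset_trans/(_ (@gamma_gens_gen k)) LR.
apply: noetherian_central LR => //; first exact: gamma_normal.
by move=> x g /gamma_gens_sub; apply: gamma_comm.
Qed.

End GammaGenerators.

(** * Free groups and comparison of presentations *)

Lemma free_basis_generated (X : Type) (F : groupType) (i : X -> F) :
  free_basis i -> generated (range i) = setT.
Proof.
move=> iP; apply/seteqP; split=> // x _.
pose H := Subgroup (generated_subgroup (range i)).
have iH u : i u \in subgroup_set H by apply/mem_set; apply: sub_generated; exists u.
have [[phi phiE] _] := iP (subgroup_type H) (fun u => SubgroupElt (iH u)).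
have [_ uniq] := iP F i.
pose vphi : {multiplicative F -> F} := val \o phi.
(* [vphi] factors through the generated subgroup and agrees with the identity on the basis. *)
have <- : vphi x = x.
  by apply: (uniq vphi idfun) => // u; rewrite /vphi /= phiE.
exact: set_mem (valP (phi x)).
Qed.

(** Projectivity of free groups: preimages are chosen on the basis, and uniqueness of extensions
    gives the equality everywhere. *)
Lemma free_lift (X : Type) (F E G : groupType) (i : X -> F)
    (p : {multiplicative F -> G}) (q : {multiplicative E -> G}) :
  free_basis i -> surjective_hom q ->
  exists f : {multiplicative F -> E}, forall x, q (f x) = p x.
Proof.
move=> iP qsurj; have [g gP] := choice (fun u => qsurj (p (i u))).
have [[f fE] _] := iP E g; exists f => x.
have [_ uniq] := iP G (p \o i).
by apply: (uniq (q \o f) p) => // u; rewrite /= fE gP.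
Qed.

Lemma fg_mod_retract (E F : groupType) (A N : set E) (B M : set F)
    (phi : {multiplicative E -> F}) (psi : {multiplicative F -> E}) :
  A `<=` phi @^-1` B -> N `<=` phi @^-1` M -> B `<=` psi @^-1` A ->
  (forall x, B x -> M (x^-1 * phi (psi x))) -> fg_mod N A -> fg_mod M B.
Proof.
move=> AB NM BA MB [s As sA]; exists (map phi s).
  by move=> _ /mapP[x xs ->]; apply/AB/As.
move=> x Bx; have sT := gen_mod_subgroup M (map phi s).
have sub : gen_mod N s `<=` phi @^-1` gen_mod M (map phi s).
  apply: gen_mod_sub; first exact: preimage_subgroup.
    by move=> y ys; apply: gen_mod_seq; apply: map_f.
  by move=> y Ny; apply: gen_mod_base; apply: NM.
(* With z = phi(psi(x)), x is z divided by x^-1 z. *)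
have := sT.2 _ _ (sub _ (sA _ (BA _ Bx))) (@gen_mod_base _ M (map phi s) _ (MB _ Bx)).
by rewrite !gnorm.
Qed.

(** * Passage to the multiplier *)

Lemma fg_mod_multiplier (F G : groupType) (pi : {multiplicative F -> G}) n :
  fg_mod (gamma (kernel pi) n.+1) (kernel pi `&` gamma setT n.+1) ->
  finitely_generated (nilpotent_multiplier pi n).
Proof.
set N := gamma _ _; set L := _ `&` _ => -[s sL Ls].
pose Q := nilpotent_multiplier pi n.
pose cls (x : subgroup_type (multiplier_num pi n)) : Q :=
  (\pi_(quotient_group (multiplier_den pi n)) x)%qT.
have clsF x y : cls (x / y) = cls x / cls y.
  rewrite /cls pi_quotientM; congr (_ * _); exact: pi_quotientV.
(* [insub] discards nothing here, since [s] lies in [L]. *)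
pose t : seq Q := [seq cls x | x <- pmap insub s].
have sT := generated_subgroup [set` t].
have sub : gen_mod N s `<=` [set x | exists2 y : subgroup_type (multiplier_num pi n),
    val y = x & generated [set` t] (cls y)].
  apply: gen_mod_sub => [|x xs|x Nx] /=.
  - split=> [|_ _ [x <- tx] [y <- ty]]; first by exists 1 => //; apply: sT.1.
    by exists (x / y) => //; rewrite clsF; apply: sT.2.
  - have Lx : x \in subgroup_set (multiplier_num pi n) by apply/mem_set/sL.
    exists (SubgroupElt Lx) => //; apply: sub_generated; apply: map_f.
    by rewrite mem_pmap_sub.
  - have Lx : x \in subgroup_set (multiplier_num pi n).
      exact/mem_set/multiplier_den_sub.
    exists (SubgroupElt Lx) => //.
    have -> : cls (SubgroupElt Lx) = 1; last exact: sT.1.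
    apply/esym/quotient_eqP; rewrite invg1 mul1g; exact: Nx.
exists t; apply/seteqP; split=> // u _; rewrite -[u]reprK.
have [y /val_inj yE] := sub _ (Ls _ (set_mem (valP (repr u)))).
by rewrite yE.
Qed.

Theorem corollary2p3 (G : groupType) (hG : finitely_presented G)
    (F : groupType) (hF : free_group F)
    (pi : {multiplicative F -> G}) (hpi : surjective_hom pi)
    (n : nat) (hn : (1 <= n)%N) :
  finitely_generated (nilpotent_multiplier pi n).
Proof.
have [k [F0 [i0 [pi0 [rels [i0P pi0_surj kerE]]]]]] := hG.
have [X [i iP]] := hF.
have [phi phiE] := free_lift pi0 i0P hpi.
have [psi psiE] := free_lift pi iP pi0_surj.
have nR := kernel_normal pi.
apply: fg_mod_multiplier.
apply: (fg_mod_retract (phi := phi) (psi := psi)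
  (A := kernel pi0 `&` gamma setT n.+1) (N := gamma (kernel pi0) n.+1)).
- move=> x [Rx Fx]; split; first by rewrite /kernel /= phiE.
  exact: (gamma_morph (f := phi) (A := setT)) Fx.
- by apply: gamma_morph => x; rewrite /kernel /= phiE.
- move=> x [Rx Fx]; split; first by rewrite /kernel /= psiE.
  exact: (gamma_morph (f := psi) (A := setT)) Fx.
(* Both lifts lie over [G], so [phi \o psi] is the identity modulo [kernel pi]. *)
- move=> x [_ Fx]; apply: (gamma_endo_congr (h := phi \o psi)) Fx => // y.
  by rewrite /kernel /= gmulfM homgV phiE psiE mulVg.
have genF0 : generated [set` codom i0] = setT.
  rewrite -(free_basis_generated i0P); congr generated.
  by apply/seteqP; split=> [_ /codomP[j ->]|_ [j _ <-]]; [exists j | exact: codom_f].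
(* What remains concerns the finite presentation alone: the numerator is a subgroup of its relation
   group. *)
rewrite kerE; apply: (noetherian_gamma genF0); last by move=> x [].
apply: is_subgroupI; first exact: (normal_closure_normal _).1.
exact: (gamma_normal _ (is_normalT F0)).1.
Qed.
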